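(* Suppose that the following hold. (K-b) There is a constant $\beta>0$ such that $\|f\|_k\le\beta$ for all $f\in\mathcal F$. (C-a) There is a gauge function $\phi:Z\to[0,\infty)$ such that $c(z,f(x))\le\phi(z)$ for all $z=(x,y)\in Z$ and $f\in\mathcal F$, and $\phi(z)\to\infty$ as $\|z\|\to\infty$. (L) There is a fixed number $p\ge 1$ such that $$|c(z,f(x))-c(z',f(x'))|\le c_p(z,z')\,\|z-z'\|\quad\text{for all } z=(x,y),\,z'=(x',y')\in Z,\ f\in\mathcal F,$$ where $c_p(z,z'):=\max\{1,\|z\|,\|z'\|\}^{p-1}$. Let $\mathcal M_Z^\phi=\{P'\in\mathscr P(Z):\int_Z\phi(z)\,P'(dz)<\infty\}$. Then for every $N\in\mathbb N$ (and regularization parameter $\lambda_N>0$) and all $P,Q\in\mathcal M_Z^\phi$, $$\mathsf d_{K,1}\left(P^{\otimes N}\circ\hat\vartheta_N(\cdot,\lambda_N)^{-1},\;Q^{\otimes N}\circ\hat\vartheta_N(\cdot,\lambda_N)^{-1}\right)\le\zeta_p(P,Q).$$ In the case $p=1$, $$\mathsf d_{K,1}\left(P^{\otimes N}\circ\hat\vartheta_N(\cdot,\lambda_N)^{-1},\;Q^{\otimes N}\circ\hat\vartheta_N(\cdot,\lambda_N)^{-1}\right)\le\mathsf d_{K,Z}(P,Q).$$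
   Context: Setting. $X$ is the input space and $Y\subseteq\mathbb R$ the output space; $X$ and $Z:=X\times Y$ are subsets of normed spaces, with norms denoted $\|\cdot\|$, and $Z$ is Polish; elements of $Z$ are written $z=(x,y)$. $\mathscr P(Z)$ is the set of Borel probability measures on $Z$. $k:X\times X\to\mathbb R$ is a given positive definite symmetric kernel (all matrices $[k(x_i,x_j)]_{ij}$ are symmetric positive semidefinite), $\mathcal H_k$ is its reproducing kernel Hilbert space (so $k(\cdot,x)\in\mathcal H_k$ and $f(x)=\langle f,k(\cdot,x)\rangle$ for $f\in\mathcal H_k$, $x\in X$), with norm $\|\cdot\|_k$. $\mathcal F$ is a (nonempty) subset of $\mathcal H_k$ of functions $X\to Y$. The cost function $c:Z\times Y\to\mathbb R$ is such that $c(z,f(x))\ge 0$. A gauge function is a continuous $\phi:Z\to[0,\infty)$ with $\phi\ge 1$ outside a compact set. Regularized empirical risk: for a sample $\vec z^N=(z^1,\dots,z^N)\in Z^{\otimes N}$ (the $N$-fold Cartesian product), $z^i=(x^i,y^i)$, and $\lambda_N>0$, $$\hat\vartheta_N(\vec z^N,\lambda_N):=\inf_{f\in\mathcal F}\Big\{\frac1N\sum_{i=1}^N c(z^i,f(x^i))+\lambda_N\|f\|_k^2\Big\}.$$ $P^{\otimes N}$ is the product measure on $Z^{\otimes N}$ with marginals $P$ (i.i.d. samples), and $P^{\otimes N}\circ\hat\vartheta_N(\cdot,\lambda_N)^{-1}$ is the law on $\mathbb R$ of $\hat\vartheta_N(\cdot,\lambda_N)$ under $P^{\otimes N}$. Fortet–Mourier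 metric of order $p\ge1$: $\zeta_p(P,Q):=\sup_{\psi\in\mathcal F_p(Z)}\left|\int_Z\psi\,dP-\int_Z\psi\,dQ\right|$, where $\mathcal F_p(Z):=\{\psi:Z\to\mathbb R:\ |\psi(z)-\psi(\tilde z)|\le c_p(z,\tilde z)\|z-\tilde z\|\ \forall z,\tilde z\in Z\}$. Kantorovich metrics: $\mathsf d_{K,1}(\mu,\nu):=\sup_g\left|\int_{\mathbb R}g\,d\mu-\int_{\mathbb R}g\,d\nu\right|$ over all $g:\mathbb R\to\mathbb R$ Lipschitz with modulus at most $1$, for probability measures $\mu,\nu$ on $\mathbb R$; $\mathsf d_{K,Z}(P,Q):=\sup_\psi\left|\int_Z\psi\,dP-\int_Z\psi\,dQ\right|$ over all $\psi:Z\to\mathbb R$ Lipschitz with modulus at most $1$ with respect to $\|\cdot\|$ (so $\mathsf d_{K,Z}=\zeta_1$). *)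

(* Defs.v *)
From HB Require Import structures.
From mathcomp Require Import all_boot all_order all_algebra.
From mathcomp Require Import all_classical all_reals all_analysis.
Set Implicit Arguments.
Unset Strict Implicit.
Unset Printing Implicit Defensive.
Import Order.TTheory GRing.Theory Num.Theory.
Import numFieldNormedType.Exports.
Local Open Scope classical_set_scope.
Local Open Scope ring_scope.

(* The norm of the space containing Z = X x Y is an arbitrary norm on the
   vector space E x R, not the max norm that the library puts on products;
   [renormed nu] is V with the norm (and the topology) of nu. *)
Record vnorm (R : realType) (V : lmodType R) := VNorm {
  vnorm_fun :> V -> R;
  vnormD : forall u v, vnorm_fun (u + v) <= vnorm_fun u + vnorm_fun v;
  vnormZ : forall (a : R) u, vnorm_fun (a *: u) = `|a| * vnorm_fun u;
  vnorm_eq0 : forall u, vnorm_fun u = 0 -> u = 0 }.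

Definition renormed (R : realType) (V : lmodType R) (nu : vnorm V) : Type := V.

HB.instance Definition _ (R : realType) (V : lmodType R) (nu : vnorm V) :=
  GRing.Lmodule.on (renormed nu).
HB.instance Definition _ (R : realType) (V : lmodType R) (nu : vnorm V) :=
  Lmodule_isNormed.Build R (renormed nu)
    (@vnormD R V nu) (@vnormZ R V nu) (@vnorm_eq0 R V nu).

(* A nonempty subset A of a normed space, with the subspace topology and its
   Borel sigma-algebra. Measurable types are pointed in the library, hence the
   argument A0; the point itself is irrelevant. *)
Definition borel_subset (R : realType) (W : normedModType R) (A : set W)
  (A0 : A !=set0) : Type := set_type A.

Section borel_subset.
Context (R : realType) (W : normedModType R) (A : set W) (A0 : A !=set0).
Local Notation T := (borel_subset A0).

HB.instance Definition _ := PseudoMetric.copy T (set_type A).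

Definition borel_subset_point : T := SigSub (mem_set (projT2 (cid A0))).
HB.instance Definition _ := isPointed.Build T borel_subset_point.

HB.instance Definition _ :=
  Measurable.copy T (g_sigma_algebraType (@open T)).

End borel_subset.

Definition data_set (R : realType) (E : normedModType R)
  (nu : vnorm (E * R^o)%type) (X : set E) (Y : set R) : set (renormed nu) :=
  X `*` Y.
Arguments data_set {R E} nu X Y.

Section data_space.
Context (R : realType) (E : normedModType R) (nu : vnorm (E * R^o)%type).
Context (X : set E) (Y : set R) (Z0 : data_set nu X Y !=set0).

Definition data_space := borel_subset Z0.

Definition pt (z : data_space) : renormed nu := \val z.

Definition input (z : data_space) : set_type X :=
  SigSub (mem_set (proj1 (set_valP z))).

End data_space.

Definition completely_metrizable (R : realType) (T : topologicalType) :=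
  exists (M : metricType R) (h : T -> M) (h' : M -> T),
    [/\ cancel h h', cancel h' h, continuous h, continuous h' &
        forall F : set_system M, ProperFilter F -> cauchy F ->
          exists l : M, F --> l].

Definition polish (R : realType) (T : topologicalType) :=
  (exists2 D : set T, countable D & dense D) /\ completely_metrizable R T.

Definition gauge (R : realType) (T : topologicalType) (phi : T -> R) :=
  [/\ continuous phi, forall z, 0 <= phi z &
      exists2 K : set T, compact K & forall z, ~ K z -> 1 <= phi z].

Definition pd_kernel (R : realType) (T : Type) (k : T -> T -> R) :=
  (forall x x', k x x' = k x' x) /\
  forall n (x : 'I_n -> T) (a : 'I_n -> R),
    0 <= \sum_(i < n) \sum_(j < n) a i * a j * k (x i) (x j).

(* A reproducing kernel Hilbert space of k: a complete inner product space
   whose elements are, through the injective linear map [rkhs_eval], real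
   functions on T. By the Moore-Aronszajn theorem it exists and is unique up to
   isometry, for every positive definite symmetric k. *)
Record rkhs (R : realType) (T : Type) (k : T -> T -> R) := RKHS {
  rkhs_space :> completeNormedModType R;
  rkhs_inner : rkhs_space -> rkhs_space -> R;
  rkhs_eval : rkhs_space -> T -> R;
  rkhs_section : T -> rkhs_space;
  rkhs_innerC : forall f g, rkhs_inner f g = rkhs_inner g f;
  rkhs_innerDZ : forall (a : R) f g h,
    rkhs_inner (a *: f + g) h = a * rkhs_inner f h + rkhs_inner g h;
  rkhs_inner_norm : forall f, rkhs_inner f f = `|f| ^+ 2;
  rkhs_evalDZ : forall (a : R) f g x,
    rkhs_eval (a *: f + g) x = a * rkhs_eval f x + rkhs_eval g x;
  rkhs_eval_inj : injective rkhs_eval;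
  rkhs_sectionE : forall x x', rkhs_eval (rkhs_section x) x' = k x' x;
  rkhs_reproducing : forall f x, rkhs_eval f x = rkhs_inner f (rkhs_section x)
}.

Notation "f <@> x" := (rkhs_eval f x) (at level 40, left associativity).

(* N-fold product of P, by P^(n+1) = (P x P^n) o cons^-1. *)
Section product_power.
Context d (T : measurableType d) (R : realType) (P : probability T R).

Definition cons_pair n (u : T * n.-tuple T) : n.+1.-tuple T :=
  [tuple of u.1 :: u.2].

Lemma measurable_cons_pair n : measurable_fun setT (@cons_pair n).
Proof. exact: measurable_cons. Qed.

HB.instance Definition _ n :=
  isMeasurableFun.Build _ _ _ _ (@cons_pair n) (@measurable_cons_pair n).

Fixpoint power_prob n : probability (n.-tuple T) R :=
  match n with
  | 0 => \d_([tuple] : 0.-tuple T)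
  | n'.+1 => distribution (P \x power_prob n')%E (@cons_pair n')
  end.

End product_power.

(* Integral probability metric: supremum of |int psi dmu - int psi dnu| over
   psi in G. For unbounded psi the integrals need not exist, so the supremum is
   over the psi that are integrable for both measures. For the classes G below,
   which are stable under truncation to [-n, n] and hence contain bounded
   approximations of their members, non-integrable psi whose integrals have a
   well-defined difference would not change the supremum. *)
Definition int_metric d (T : measurableType d) (R : realType)
    (G : set (T -> R)) (mu nu : set T -> \bar R) : \bar R :=
  ereal_sup [set `| \int[mu]_z (psi z)%:E - \int[nu]_z (psi z)%:E |%E
    | psi in [set psi | [/\ G psi, mu.-integrable setT (EFin \o psi)
                          & nu.-integrable setT (EFin \o psi)]]].

Definition dK1 (R : realType) (mu nu : set (measurableTypeR R) -> \bar R) :=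
  int_metric [set g : R -> R | 1.-lipschitz g] mu nu.

Section metrics_on_data.
Context (R : realType) (E : normedModType R) (nu : vnorm (E * R^o)%type).
Context (X : set E) (Y : set R) (Z0 : data_set nu X Y !=set0).
Local Notation Z := (data_space Z0).

Definition growth (p : R) (z z' : Z) : R :=
  (Num.max 1 (Num.max `|pt z| `|pt z'|)) `^ (p - 1).

Definition FM_class (p : R) : set (Z -> R) :=
  [set psi | forall z z' : Z,
    `|psi z - psi z'| <= growth p z z' * `|pt z - pt z'|].

Definition zeta (p : R) (P Q : probability Z R) : \bar R :=
  int_metric (FM_class p) P Q.

Definition dKZ (P Q : probability Z R) : \bar R :=
  int_metric [set psi : Z -> R |
    forall z z' : Z, `|psi z - psi z'| <= `|pt z - pt z'|] P Q.

(* The cost c is defined on Z x R; only its values c z (f x) with f x in Y are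
   ever used. *)
Definition emp_risk (k : set_type X -> set_type X -> R) (H : rkhs k)
    (c : Z -> R -> R) N (lambda : R) (zs : N.-tuple Z) (f : H) : R :=
  N%:R^-1 * (\sum_(i < N) c (tnth zs i) (f <@> input (tnth zs i)))
  + lambda * `|f| ^+ 2.

Definition opt_risk (k : set_type X -> set_type X -> R) (H : rkhs k)
    (F : set H) (c : Z -> R -> R) N (lambda : R) (zs : N.-tuple Z) : R :=
  inf [set emp_risk c lambda zs f | f in F].

(* Law of opt_risk under P^N. Under the assumptions of the theorem opt_risk is
   continuous, so this set function is a probability measure. *)
Definition law_opt_risk (k : set_type X -> set_type X -> R) (H : rkhs k)
    (F : set H) (c : Z -> R -> R) N (lambda : R) (P : probability Z R) :
    set (measurableTypeR R) -> \bar R :=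
  pushforward (power_prob P N)
    (opt_risk F c lambda : N.-tuple Z -> measurableTypeR R).

End metrics_on_data.

(* Main.v *)
(* The optimal risk is, in each sample point, Lipschitz with constant 1/N for the
   Fortet-Mourier modulus. Replacing P by Q one coordinate at a time, Fubini
   reduces each step to the integral over one coordinate of a partial average of
   g(opt_risk), which is 1/N times a member of the Fortet-Mourier class; every
   step therefore costs at most zeta_p(P, Q) / N. Integrability comes from the
   bound of the optimal risk by the average of phi. *)
Require Import Defs.
From HB Require Import structures.
From mathcomp Require Import all_boot all_order all_algebra.
From mathcomp Require Import all_classical all_reals all_analysis.
From mathcomp Require Import measurable_realfun lra.
Set Implicit Arguments.
Unset Strict Implicit.
Unset Printing Implicit Defensive.
Import Order.TTheory GRing.Theory Num.Theory.
Import numFieldNormedType.Exports.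
Local Open Scope classical_set_scope.
Local Open Scope ring_scope.

(** * Integrals over products of two probability spaces *)

Lemma integrable_comp_fst d1 d2 (T1 : measurableType d1) (T2 : measurableType d2)
    (R : realType) (P : probability T1 R) (Q : probability T2 R) (f : T1 -> R) :
  P.-integrable setT (EFin \o f) ->
  (P \x Q)%E.-integrable setT (EFin \o (f \o fst)).
Proof.
move=> /integrableP[/measurable_EFinP mf foo]; apply/integrable12ltyP.
  by apply/measurable_EFinP; exact: measurableT_comp mf measurable_fst.
rewrite (eq_integral (fun x => `|(f x)%:E|%E))//= => x _.
by rewrite integral_cst//= probability_setT mule1.
Qed.

Lemma integrable_comp_snd d1 d2 (T1 : measurableType d1) (T2 : measurableType d2)
    (R : realType) (P : probability T1 R) (Q : probability T2 R) (f : T2 -> R) :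
  Q.-integrable setT (EFin \o f) ->
  (P \x Q)%E.-integrable setT (EFin \o (f \o snd)).
Proof.
move=> /integrableP[/measurable_EFinP mf foo]; apply/integrable21ltyP.
  by apply/measurable_EFinP; exact: measurableT_comp mf measurable_snd.
rewrite (eq_integral (fun x => `|(f x)%:E|%E))//= => x _.
by rewrite integral_cst//= probability_setT mule1.
Qed.

(** Integrability of every section, not just of almost every one, makes [fubini_F] finite
    everywhere, so that it equals the real-valued inner integral as a function. *)
Lemma Rintegral_Fubini d1 d2 (T1 : measurableType d1) (T2 : measurableType d2)
    (R : realType) (P : probability T1 R) (Q : probability T2 R)
    (f : T1 * T2 -> R) :
  (P \x Q)%E.-integrable setT (EFin \o f) ->
  (forall x, Q.-integrable setT (fun y => (f (x, y))%:E)) ->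
  P.-integrable setT (EFin \o (fun x => \int[Q]_y f (x, y))) /\
  \int[(P \x Q)%E]_u f u = \int[P]_x \int[Q]_y f (x, y).
Proof.
move=> fi fxi.
have FE : fubini_F Q (EFin \o f) = EFin \o (fun x => \int[Q]_y f (x, y)).
  by apply/funext => x; rewrite /fubini_F/= fineK//; apply: integrable_fin_num.
split; first by rewrite -FE; exact: integrable_fubini_F.
by rewrite /Rintegral; congr fine; rewrite -integral12_prod_meas1// FE.
Qed.

Lemma integrable_EFin_le d (T : measurableType d) (R : realType)
    (P : probability T R) (f g : T -> R) : measurable_fun setT f ->
  (forall x, `|f x| <= g x) ->
  P.-integrable setT (EFin \o g) -> P.-integrable setT (EFin \o f).
Proof.
move=> mf fg; apply: le_integrable => //; first exact: measurableT_comp.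
by move=> x _ /=; rewrite lee_fin (le_trans (fg x))// ler_norm.
Qed.

Lemma integrable_EFinD d (T : measurableType d) (R : realType)
    (P : probability T R) (f g : T -> R) :
  P.-integrable setT (EFin \o f) -> P.-integrable setT (EFin \o g) ->
  P.-integrable setT (EFin \o (f \+ g)).
Proof. by move=> fi gi; exact: integrableD fi gi. Qed.

Lemma integrable_EFinB d (T : measurableType d) (R : realType)
    (P : probability T R) (f g : T -> R) :
  P.-integrable setT (EFin \o f) -> P.-integrable setT (EFin \o g) ->
  P.-integrable setT (EFin \o (f \- g)).
Proof. by move=> fi gi; exact: integrableB fi gi. Qed.

Lemma normr_RintegralB_le d (T : measurableType d) (R : realType)
    (P : probability T R) (f g : T -> R) (b : R) :
  P.-integrable setT (EFin \o f) -> P.-integrable setT (EFin \o g) ->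
  (forall x, `|f x - g x| <= b) ->
  `|\int[P]_x f x - \int[P]_x g x| <= b.
Proof.
move=> fi gi fgb; rewrite -RintegralB//.
have fgi := integrable_EFinB fi gi.
apply: (le_trans (le_normr_Rintegral _ fgi)) => //.
have -> : b = \int[P]_x cst b x.
    by rewrite Rintegral_cst// [fine _](congr1 fine (probability_setT P)) mulr1.
apply: le_Rintegral => [//|||x _]; last exact: fgb.
  exact: integrable_norm fgi.
exact: finite_measure_integrable_cst.
Qed.

(** * Product powers and the exchange of one marginal at a time *)

Section power_prob.
Context d (T : measurableType d) (R : realType).
Implicit Types (P Q : probability T R) (phi : T -> R).

(** This growth class is stable under freezing the first coordinate, and its members are integrable
    for the product measures below once [phi] is integrable for each factor. *)
Definition dominated phi n (G : n.-tuple T -> R) :=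
  measurable_fun setT G /\
  exists C, forall zs, `|G zs| <= C + \sum_(i < n) phi (tnth zs i).

Lemma sum_tnth_cons (f : T -> R) n (z : T) (zs : n.-tuple T) :
  \sum_(i < n.+1) f (tnth (cons_pair (z, zs)) i) =
  f z + \sum_(i < n) f (tnth zs i).
Proof.
by rewrite big_ord_recl tnth0; congr (_ + _); apply: eq_bigr => i _; rewrite tnthS.
Qed.

Lemma dominated_cons phi n (G : n.+1.-tuple T -> R) z :
  dominated phi G -> dominated phi (fun zs => G (cons_pair (z, zs))).
Proof.
move=> [mG [C GC]]; split.
  apply: (measurableT_comp mG); apply: (measurableT_comp (@measurable_cons_pair _ _ n)).
  exact: measurable_fun_pair.
by exists (C + phi z) => zs; rewrite -addrA -sum_tnth_cons.
Qed.

Lemma integrable_sum_tnth P phi n : P.-integrable setT (EFin \o phi) ->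
  (power_prob P n).-integrable setT
    (EFin \o (fun zs => \sum_(i < n) phi (tnth zs i))).
Proof.
move=> phii; elim: n => [|n IH].
  rewrite (_ : _ \o _ = cst 0%E); first exact: integrable0.
  by apply/funext => zs /=; rewrite big_ord0.
have [mphi _] := integrableP _ _ _ phii.
apply: integrable_pushforward => //.
  apply/measurable_EFinP; apply: measurable_sum => i.
  by apply: measurableT_comp (measurable_tnth i); exact/measurable_EFinP.
rewrite preimage_setT.
rewrite (_ : _ \o _ = EFin \o ((phi \o fst) \+
    ((fun zs : n.-tuple T => \sum_(i < n) phi (tnth zs i)) \o snd))).
  apply: integrable_EFinD; [exact: integrable_comp_fst|exact: integrable_comp_snd].
by apply/funext => -[z zs]; rewrite /= sum_tnth_cons.
Qed.

Lemma dominated_integrable P phi n (G : n.-tuple T -> R) :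
  P.-integrable setT (EFin \o phi) -> dominated phi G ->
  (power_prob P n).-integrable setT (EFin \o G).
Proof.
move=> phii [mG [C GC]]; apply: integrable_EFin_le GC _ => //.
apply: (@integrable_EFinD _ _ _ _ (cst C)).
  exact: finite_measure_integrable_cst.
exact: integrable_sum_tnth.
Qed.

(** The mixed measure occurs when the marginals of the tail have been exchanged and that of the head
    has not. *)
Lemma dominated_integrable_cons P Q phi n (G : n.+1.-tuple T -> R) :
  P.-integrable setT (EFin \o phi) -> Q.-integrable setT (EFin \o phi) ->
  dominated phi G ->
  (P \x power_prob Q n)%E.-integrable setT (EFin \o (G \o @cons_pair _ _ n)).
Proof.
move=> Pphi Qphi [mG [C GC]].
apply: (@integrable_EFin_le _ _ _ _ _ (fun u => C + (phi u.1 + \sum_(i < n) phi (tnth u.2 i)))).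
- by apply: (measurableT_comp mG); exact: measurable_cons_pair.
- by move=> [z zs] /=; rewrite -sum_tnth_cons.
apply: (@integrable_EFinD _ _ _ _ (cst C)).
  exact: finite_measure_integrable_cst.
apply: (@integrable_EFinD _ _ _ _ (phi \o fst)
  ((fun zs : n.-tuple T => \sum_(i < n) phi (tnth zs i)) \o snd)).
  exact: integrable_comp_fst.
by apply: integrable_comp_snd; exact: integrable_sum_tnth.
Qed.

Lemma Rintegral_power_probS P phi n (G : n.+1.-tuple T -> R) :
  P.-integrable setT (EFin \o phi) -> dominated phi G ->
  \int[power_prob P n.+1]_zs G zs =
  \int[P]_z \int[power_prob P n]_zs G (cons_pair (z, zs)).
Proof.
move=> Pphi domG.
have Gi := dominated_integrable_cons Pphi Pphi domG.
have [_ <-] := Rintegral_Fubini Gi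
  (fun z => dominated_integrable Pphi (dominated_cons z domG)).
rewrite /Rintegral; congr fine.
rewrite integral_pushforward//=.
by case: domG => mG _; exact/measurable_EFinP.
Qed.

(** The induction runs over the number of coordinates while the Lipschitz constant [a] stays fixed,
    so [a] is kept separate from [n]; each coordinate contributes one term [a * s]. *)
Lemma power_prob_dist P Q phi (omega : T -> T -> R) (s a : R) :
  P.-integrable setT (EFin \o phi) -> Q.-integrable setT (EFin \o phi) ->
  (forall z, omega z z = 0) -> 0 < a ->
  (forall psi : T -> R, (forall z z', `|psi z - psi z'| <= omega z z') ->
    P.-integrable setT (EFin \o psi) -> Q.-integrable setT (EFin \o psi) ->
    `|\int[P]_z psi z - \int[Q]_z psi z| <= s) ->
  forall n (G : n.-tuple T -> R), dominated phi G ->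
  (forall zs zs', `|G zs - G zs'| <=
    a * \sum_(i < n) omega (tnth zs i) (tnth zs' i)) ->
  `|\int[power_prob P n]_zs G zs - \int[power_prob Q n]_zs G zs|
    <= (a * s) *+ n.
Proof.
move=> Pphi Qphi omega0 a0 hs; elim=> [|n IH] G domG lipG.
  by rewrite subrr normr0 mulr0n.
have cons_int (mu : probability T R) z : mu.-integrable setT (EFin \o phi) ->
    (power_prob mu n).-integrable setT (EFin \o (fun zs => G (cons_pair (z, zs)))).
  by move=> muphi; exact: dominated_integrable muphi (dominated_cons z domG).
pose h (mu : probability T R) z := \int[power_prob mu n]_zs G (cons_pair (z, zs)).
have h_int (mu mu' : probability T R) : mu.-integrable setT (EFin \o phi) ->
    mu'.-integrable setT (EFin \o phi) -> mu.-integrable setT (EFin \o h mu').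
  move=> muphi mu'phi.
  exact: (Rintegral_Fubini (dominated_integrable_cons muphi mu'phi domG)
    (fun z => cons_int _ z mu'phi)).1.
rewrite (Rintegral_power_probS Pphi domG) (Rintegral_power_probS Qphi domG).
(* The inserted term integrates [G] against [P] on the head and the power of [Q] on the tail: the
   first difference exchanges the tail and costs [n] terms [a * s], the second exchanges the head
   and costs one. *)
rewrite -(subrKA (\int[P]_z h Q z)) (le_trans (ler_normD _ _))// mulrSr lerD//.
- apply: normr_RintegralB_le => [||z]; [exact: h_int..|].
  apply: IH => [|zs zs']; first exact: dominated_cons.
  (* Both tuples share the head [z], whose term vanishes because [omega] is zero on the diagonal. *)
  apply: (le_trans (lipG _ _)); rewrite big_ord_recl tnth0 omega0 add0r.
  by under eq_bigr do rewrite !tnthS.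
(* Rescaling by [a^-1] gives the partial average [h Q] the modulus [omega], as [hs] demands. *)
- have -> : \int[P]_z h Q z - \int[Q]_z h Q z =
     a * (\int[P]_z (a^-1 * h Q z) - \int[Q]_z (a^-1 * h Q z)).
    by rewrite !RintegralZl//; [|exact: h_int..]; rewrite -mulrBr mulVKf// gt_eqF.
  rewrite normrM gtr0_norm// ler_pM2l//; apply: hs => [z z'||].
  + rewrite -mulrBr normrM gtr0_norm ?invr_gt0// ler_pdivrMl//.
    apply: normr_RintegralB_le => [||zs]; [exact: cons_int..|].
    apply: (le_trans (lipG _ _)).
    (* The tails coincide here, so the head term alone survives. *)
    rewrite big_ord_recl !tnth0 [X in _ + X]big1 ?addr0// => i _.
    by rewrite !tnthS omega0.
  + exact: (integrableZl measurableT a^-1 (h_int _ _ Pphi Qphi)).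
  + exact: (integrableZl measurableT a^-1 (h_int _ _ Qphi Qphi)).
Qed.

End power_prob.

(** * Measurability for the product sigma-algebra *)

(* G zs is the infimum over the countable set of tuples e with entries in the
   dense sequence u of G e + a * sum_i omega (zs_i) (e_i), and each of these
   functions is measurable for the product sigma-algebra, which G need not be
   merely by virtue of being continuous. *)
Lemma measurable_fun_tuple_modulus d (T : measurableType d) (R : realType)
    (omega : T -> T -> R) (u : nat -> T) (a : R) n (G : n.-tuple T -> R) :
  (forall e, measurable_fun setT (omega ^~ e)) ->
  (forall z z', omega z z' = omega z' z) ->
  (forall z eps, 0 < eps -> exists m, omega z (u m) < eps) ->
  0 <= a ->
  (forall zs zs', `|G zs - G zs'| <=
    a * \sum_(i < n) omega (tnth zs i) (tnth zs' i)) ->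
  measurable_fun setT G.
Proof.
move=> momega omegaC udense a0 lipG.
pose near_ (t : n.-tuple nat) (zs : n.-tuple T) : R :=
  G (map_tuple u t) + a * \sum_(i < n) omega (tnth zs i) (u (tnth t i)).
have mnear t : measurable_fun setT (near_ t).
  apply: measurable_funD => //; apply: measurable_funM => //.
  apply: measurable_sum => i.
  exact: measurableT_comp (momega _) (measurable_tnth i).
(* Open left rays generate the Borel sets, and an infimum is strictly below [b] iff some member of
   the family is, whence a union of preimages. *)
apply: (measurability _ (RGenInftyO.measurableE R)) => _ [_ [b ->] <-].
have -> : [set: n.-tuple T] `&` G @^-1` `]-oo, b[ =
    \bigcup_(t in [set: n.-tuple nat]) ([set: n.-tuple T] `&` near_ t @^-1` `]-oo, b[).
  rewrite setTI; under eq_bigcupr do rewrite setTI.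
  apply/seteqP; split=> [zs /=|zs [t _]]; rewrite /= !in_itv/=; last first.
    (* The modulus bound gives [G zs <= near_ t zs] for every [t]. *)
    apply: le_lt_trans; rewrite /near_ addrC -lerBlDr.
    apply: (le_trans (ler_norm _)); apply: (le_trans (lipG _ _)).
    by under eq_bigr do rewrite tnth_map.
  (* Approximating each entry up to [del] costs at most [a * n * del] twice, in the change of [G]
     and in the added sum; the summand 1 keeps the total strictly below [b - G zs] and the
     denominator positive. *)
  move=> Gb; pose del := (b - G zs) / (2 * a * n%:R + 1).
  have den0 : 0 < 2 * a * n%:R + 1 by rewrite ltr_wpDl// !mulr_ge0.
  have del0 : 0 < del by rewrite divr_gt0// subr_gt0.
  have /choice[m mP] (i : 'I_n) := udense (tnth zs i) _ del0.
  exists (mktuple m) => //=; rewrite in_itv/= /near_.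
  have sum_le : a * \sum_(i < n) omega (tnth zs i) (u (tnth (mktuple m) i)) <= a * (del * n%:R).
    rewrite ler_wpM2l// mulr_natr -[X in _ *+ X]card_ord -sumr_const ler_sum// => i _.
    by rewrite tnth_mktuple ltW.
  have := lipG (map_tuple u (mktuple m)) zs.
  under eq_bigr do rewrite tnth_map omegaC.
  move=> /(le_trans (ler_norm _)) dG.
  have delE : del * (2 * a * n%:R + 1) = b - G zs by rewrite divfK// gt_eqF.
  by lra.
apply: countable_bigcupT_measurable => [|t]; first exact: countableP.
by apply: mnear => //; exact: measurable_itv.
Qed.

(** An injection of [D] into [nat] is inverted. Codes outside its image go to the default [point],
    which is harmless: the sequence still runs through all of [D]. *)
Lemma dense_countable_seq (T : ptopologicalType) (D : set T) :
  countable D -> dense D ->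
  exists u : nat -> T, forall O, O !=set0 -> open O -> exists m, O (u m).
Proof.
move=> /countable_injP[f finj] Ddense.
exists ('pinv_(fun=> point) D f) => O O0 oO.
have [z [Oz Dz]] := Ddense O O0 oO.
by exists (f z); rewrite pinvKV// inE.
Qed.

Lemma continuous_dist (R : realType) (V : normedModType R) (w : V) :
  continuous (fun v : V => `|v - w|).
Proof. by move=> v; apply: cvg_norm; apply: cvgB; [exact: cvg_id|exact: cvg_cst]. Qed.

(** * Topology and Fortet-Mourier modulus on the data space *)

Section data_space.
Context (R : realType) (E : normedModType R) (nu : vnorm (E * R^o)%type).
Context (X : set E) (Y : set R) (Z0 : data_set nu X Y !=set0).
Local Notation Z := (data_space Z0).

Lemma pt_continuous : continuous (@pt R E nu X Y Z0).
Proof. exact: initial_continuous. Qed.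

Lemma data_space_continuous_measurable (f : Z -> R) :
  continuous f -> measurable_fun setT f.
Proof.
move=> /continuousP cf; apply: (measurability _ (RGenOpens.measurableE R)).
move=> _ [_ [a [b ->] <-]]; rewrite setTI; apply: sub_sigma_algebra.
by apply: cf; exact: interval_open.
Qed.

Lemma continuous_pt_dist (w : renormed nu) :
  continuous (fun z : Z => `|pt z - w|).
Proof.
move=> z; apply: (@continuous_comp Z (renormed nu) R (@pt R E nu X Y Z0)
  (fun w' => `|w' - w|)); first exact: pt_continuous.
exact: continuous_dist.
Qed.

Definition modulus (p : R) (z z' : Z) := growth p z z' * `|pt z - pt z'|.

Lemma modulusC p z z' : modulus p z z' = modulus p z' z.
Proof. by rewrite /modulus /growth distrC; congr (Num.max _ _ `^ _ * _); rewrite maxC. Qed.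

Lemma modulusxx p z : modulus p z z = 0.
Proof. by rewrite /modulus subrr normr0 mulr0. Qed.

Lemma measurable_modulus p z' : measurable_fun setT (fun z => modulus p z z').
Proof.
have mnorm : measurable_fun setT (fun z : Z => `|pt z|).
  apply: data_space_continuous_measurable.
  by under [X in continuous X]funext do rewrite -[pt _]subr0; exact: continuous_pt_dist.
apply: measurable_funM.
  apply: (@measurableT_comp _ _ _ _ _ _ (@powR R ^~ (p - 1))) => //.
  by apply: measurable_maxr => //; exact: measurable_maxr.
by apply: data_space_continuous_measurable; exact: continuous_pt_dist.
Qed.

(** Within distance 1 of [z] the growth factor is at most the constant [M], so there the modulus is
    dominated by a multiple of the norm distance. *)
Lemma small_modulus p z (eps : R) : 1 <= p -> 0 < eps ->
  exists2 O : set Z, O z /\ open O & forall z', O z' -> modulus p z z' < eps.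
Proof.
move=> p1 eps0; pose M : R := (1 + `|pt z|) `^ (p - 1).
have M1 : 1 <= 1 + `|pt z| by rewrite lerDl.
have M0 : 0 < M by rewrite powR_gt0// (lt_le_trans _ M1).
pose f (z' : Z) := `|pt z' - pt z|.
exists (f @^-1` [set r | r < Num.min 1 (eps / M)]).
  split; first by rewrite /= /f subrr normr0 lt_min ltr01 divr_gt0.
  apply: open_comp; last exact: open_lt.
  by move=> z' _; exact: continuous_pt_dist.
move=> z' /=; rewrite /f distrC lt_min => /andP[f1 feps].
have growth_le : growth p z z' <= M.
  rewrite ge0_ler_powR ?nnegrE ?subr_ge0// ?le_max ?ler01 ?(le_trans ler01)//.
  rewrite !ge_max M1 lerDr ler01/=.
  rewrite -[pt z'](subKr (pt z)) (le_trans (ler_normB _ _))// addrC lerD2r ltW//.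
apply: (@le_lt_trans _ _ (M * `|pt z - pt z'|)); first by rewrite ler_wpM2r.
by rewrite mulrC -ltr_pdivlMr.
Qed.

(** Separability gives a sequence meeting every nonempty open set, in particular the neighbourhoods
    from [small_modulus]. *)
Lemma polish_modulus_seq p : polish R Z -> 1 <= p ->
  exists u : nat -> Z, forall z eps, 0 < eps -> exists m, modulus p z (u m) < eps.
Proof.
move=> [[D cD dD] _] p1; have [u uP] := dense_countable_seq cD dD.
exists u => z eps eps0; have [U [Uz oU] Ueps] := small_modulus z p1 eps0.
have [|m Um] := uP U _ oU; first by exists z.
by exists m; exact: Ueps.
Qed.

Lemma growth1 (z z' : Z) : growth 1 z z' = 1.
Proof. by rewrite /growth subrr powRr0. Qed.

Lemma zeta1E (P Q : probability Z R) : zeta 1 P Q = dKZ P Q.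
Proof.
rewrite /zeta /dKZ; congr int_metric; apply/funext => psi; apply/propext.
by split => psiL z z'; have := psiL z z'; rewrite growth1 mul1r.
Qed.

End data_space.

Lemma nonexpansive_continuous (R : realType) (g : R -> R) :
  (forall x y, `|g x - g y| <= `|x - y|) -> continuous g.
Proof.
move=> g_lip x; apply/cvgrPdist_lt => e e0.
near=> y; rewrite (le_lt_trans (g_lip _ _))//.
Unshelve. all: by end_near.
Qed.

(** * Growth and modulus of continuity of the optimal risk *)

Section opt_risk.
Context (R : realType) (E : normedModType R) (nu : vnorm (E * R^o)%type).
Context (X : set E) (Y : set R) (Z0 : data_set nu X Y !=set0).
Local Notation Z := (data_space Z0).
Context (k : set_type X -> set_type X -> R) (H : rkhs k) (F : set H).
Context (c : Z -> R -> R) (lambda : R).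
Hypothesis F0 : F !=set0.
Hypothesis c_ge0 : forall (z : Z) f, F f -> 0 <= c z (f <@> input z).
Hypothesis lambda_ge0 : 0 <= lambda.

Lemma emp_risk_ge0 N (zs : N.-tuple Z) f : F f -> 0 <= emp_risk c lambda zs f.
Proof.
move=> Ff; rewrite addr_ge0 ?mulr_ge0 ?invr_ge0 ?sqr_ge0 ?ler0n//.
by apply: sumr_ge0 => i _; exact: c_ge0.
Qed.

(** Nonnegative costs bound the set of risks below, so its real [inf] is a true infimum and not a
    default value. *)
Lemma opt_risk_le_emp N (zs : N.-tuple Z) f :
  F f -> opt_risk F c lambda zs <= emp_risk c lambda zs f.
Proof.
move=> Ff; apply: ge_inf; last by exists f.
by exists 0 => _ [g Fg <-]; exact: emp_risk_ge0.
Qed.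

Lemma opt_risk_ge N (zs : N.-tuple Z) b :
  (forall f, F f -> b <= emp_risk c lambda zs f) -> b <= opt_risk F c lambda zs.
Proof.
move=> Fb; apply: lb_le_inf => [|_ [f Ff <-]]; last exact: Fb.
by have [f Ff] := F0; exists (emp_risk c lambda zs f); exists f.
Qed.

(** Any member of [F] serves as competitor. The weight [N%:R^-1] sits inside the sum to match
    [dominated] for the rescaled gauge. *)
Lemma opt_risk_bound phi beta N (zs : N.-tuple Z) :
  (forall f, F f -> `|f| <= beta) ->
  (forall (z : Z) f, F f -> c z (f <@> input z) <= phi z) ->
  `|opt_risk F c lambda zs| <=
    lambda * beta ^+ 2 + \sum_(i < N) N%:R^-1 * phi (tnth zs i).
Proof.
move=> F_bounded c_le_phi; rewrite ger0_norm; last first.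
  by apply: opt_risk_ge => f; exact: emp_risk_ge0.
have [f Ff] := F0; apply: le_trans (opt_risk_le_emp zs Ff) _.
rewrite addrC lerD//; last first.
  by rewrite ler_wpM2l// lerXn2r ?nnegrE// ?F_bounded// (le_trans (normr_ge0 f)) ?F_bounded.
rewrite -mulr_sumr ler_wpM2l ?invr_ge0 ?ler0n//.
by apply: ler_sum => i _; exact: c_le_phi.
Qed.

(** For fixed [f] the penalty cancels and the averaged costs have this modulus, uniformly in [f]; an
    infimum inherits a common modulus. *)
Lemma opt_risk_modulus p N (zs zs' : N.-tuple Z) :
  (forall (z z' : Z) f, F f ->
    `|c z (f <@> input z) - c z' (f <@> input z')| <= modulus p z z') ->
  `|opt_risk F c lambda zs - opt_risk F c lambda zs'| <=
    N%:R^-1 * \sum_(i < N) modulus p (tnth zs i) (tnth zs' i).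
Proof.
move=> c_lip.
(* The modulus is symmetric, so a one-sided bound suffices. *)
suff le_half (ws ws' : N.-tuple Z) : opt_risk F c lambda ws - opt_risk F c lambda ws' <=
    N%:R^-1 * \sum_(i < N) modulus p (tnth ws i) (tnth ws' i).
  rewrite ler_norml lerNl opprB le_half andbT.
  by under eq_bigr do rewrite modulusC; exact: le_half.
rewrite lerBlDr -lerBlDl; apply: opt_risk_ge => f Ff.
rewrite lerBlDl; apply: le_trans (opt_risk_le_emp ws Ff) _.
rewrite /emp_risk addrA lerD2r -mulrDr ler_wpM2l ?invr_ge0 ?ler0n//.
rewrite -big_split; apply: ler_sum => i _ /=.
by rewrite -lerBlDr (le_trans (ler_norm _))// c_lip.
Qed.

End opt_risk.

(** * Comparison of the laws of the optimal risk *)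

Theorem theorem4p2 (R : realType) (E : normedModType R)
    (nu : vnorm (E * R^o)%type)
    (X : set E) (Y : set R) (Z0 : data_set nu X Y !=set0)
    (Z_polish : polish R (data_space Z0))
    (k : set_type X -> set_type X -> R) (k_pd : pd_kernel k) (H : rkhs k)
    (F : set H) (F0 : F !=set0)
    (FY : forall f, F f -> forall x : set_type X, Y (f <@> x))
    (c : data_space Z0 -> R -> R)
    (c_ge0 : forall (z : data_space Z0) f, F f -> 0 <= c z (f <@> input z))
    (* (K-b) *)
    (beta : R) (beta_gt0 : 0 < beta)
    (F_bounded : forall f, F f -> `|f| <= beta)
    (* (C-a) *)
    (phi : data_space Z0 -> R) (phi_gauge : gauge phi)
    (c_le_phi : forall (z : data_space Z0) f, F f -> c z (f <@> input z) <= phi z)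
    (phi_infty : forall M : R, exists r : R,
      forall z : data_space Z0, r <= `|pt z| -> M <= phi z)
    (* (L) *)
    (p : R) (p_ge1 : 1 <= p)
    (c_lip : forall (z z' : data_space Z0) f, F f ->
      `|c z (f <@> input z) - c z' (f <@> input z')|
        <= growth p z z' * `|pt z - pt z'|)
    (N : nat) (N_gt0 : (0 < N)%N) (lambda : R) (lambda_gt0 : 0 < lambda)
    (P Q : probability (data_space Z0) R)
    (P_phi : (\int[P]_z (phi z)%:E < +oo)%E)
    (Q_phi : (\int[Q]_z (phi z)%:E < +oo)%E) :
  (dK1 (law_opt_risk F c N lambda P) (law_opt_risk F c N lambda Q)
     <= zeta p P Q)%E /\
  (p = 1 ->
   (dK1 (law_opt_risk F c N lambda P) (law_opt_risk F c N lambda Q)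
      <= dKZ P Q)%E).
Proof.
suff dK1_le : (dK1 (law_opt_risk F c N lambda P) (law_opt_risk F c N lambda Q)
    <= zeta p P Q)%E by split=> // p1; rewrite -zeta1E -[X in zeta X]p1.
have [cphi phi0 _] := phi_gauge.
have phi_int (mu : probability (data_space Z0) R) : (\int[mu]_z (phi z)%:E < +oo)%E ->
    mu.-integrable setT (EFin \o (fun z => N%:R^-1 * phi z)).
  move=> phi_fin; suff phii : mu.-integrable setT (EFin \o phi).
    exact: (integrableZl measurableT N%:R^-1 phii).
  apply/integrableP; split.
    by apply/measurable_EFinP; exact: data_space_continuous_measurable.
  by under eq_integral do rewrite /= ger0_norm//.
have lambda_ge0 := ltW lambda_gt0.
have lip (zs zs' : N.-tuple (data_space Z0)) :
  `|opt_risk F c lambda zs - opt_risk F c lambda zs'| <=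
    N%:R^-1 * \sum_(i < N) modulus p (tnth zs i) (tnth zs' i).
  exact: opt_risk_modulus.
have [u udense] := polish_modulus_seq Z_polish p_ge1.
have tuple_measurable (G : N.-tuple (data_space Z0) -> R) :
    (forall zs zs', `|G zs - G zs'| <=
      N%:R^-1 * \sum_(i < N) modulus p (tnth zs i) (tnth zs' i)) ->
    measurable_fun setT G.
  apply: measurable_fun_tuple_modulus udense _ => //.
  - exact: measurable_modulus.
  - exact: modulusC.
have mopt := tuple_measurable _ lip.
apply: ge_ereal_sup => _ [g [g_lip g_intP g_intQ] <-].
have {}g_lip x y : `|g x - g y| <= `|x - y|.
  by have := g_lip (x, y) (conj I I); rewrite /= mul1r.
pose G (zs : N.-tuple (data_space Z0)) := g (opt_risk F c lambda zs).
have G_lip zs zs' : `|G zs - G zs'| <=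
    N%:R^-1 * \sum_(i < N) modulus p (tnth zs i) (tnth zs' i).
  by apply: le_trans (g_lip _ _) _.
have domG : dominated (fun z => N%:R^-1 * phi z) G.
  split; first exact: tuple_measurable.
  (* The term at 0 comes from bounding [g x] by its value at 0 plus the absolute value of [x], the
     other from the penalty in [opt_risk_bound]. *)
  exists (`|g 0| + lambda * beta ^+ 2) => zs; rewrite -addrA.
  rewrite -[G zs](subrK (g 0)) (le_trans (ler_normD _ _))// [leLHS]addrC lerD2l.
  apply: (le_trans (g_lip _ _)); rewrite subr0.
  exact: opt_risk_bound.
have mg : measurable_fun setT g.
  by apply: continuous_measurable_fun; exact: nonexpansive_continuous.
(* Change of variables carries the integral from the line to the sample space, where it is
   finite. *)
have law_int (mu : probability (data_space Z0) R) : (\int[mu]_z (phi z)%:E < +oo)%E ->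
    (\int[(law_opt_risk F c N lambda mu : set R -> \bar R)]_x (g x)%:E)%E =
    (\int[power_prob mu N]_zs G zs)%:E.
  move=> mu_phi; have Gi := dominated_integrable (phi_int _ mu_phi) domG.
  rewrite integral_pushforward//=; last exact/measurable_EFinP.
  by rewrite /Rintegral fineK//; exact: integrable_fin_num.
rewrite !law_int// -EFinB abse_EFin.
have zeta_ub psi : FM_class p psi -> P.-integrable setT (EFin \o psi) ->
    Q.-integrable setT (EFin \o psi) ->
    (`|\int[P]_z psi z - \int[Q]_z psi z|%:E <= zeta p P Q)%E.
  move=> psiL psiP psiQ; rewrite -abse_EFin EFinB.
  rewrite /Rintegral !fineK; [|exact: integrable_fin_num..].
  by apply: ereal_sup_ubound; exists psi.
(* The zero function belongs to the class, which excludes the value [-oo]; at [+oo] the claim is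
   trivial, so a real value [s] remains. *)
have zeta_ge0 : (0 <= zeta p P Q)%E.
  apply: (@le_trans _ _ `|\int[P]_z cst 0 z - \int[Q]_z cst 0 z|%:E).
    by rewrite lee_fin.
  apply: zeta_ub; [|exact: finite_measure_integrable_cst..].
  by move=> z z'; rewrite subrr normr0 mulr_ge0// powR_ge0.
case: (zeta p P Q) zeta_ge0 zeta_ub => [s| |//] _ zeta_ub; last by rewrite leey.
rewrite lee_fin.
(* With [a] the inverse of [N], the [N] exchanges add up to exactly [s]. *)
have := @power_prob_dist _ _ _ P Q _ (modulus p) s N%:R^-1 (phi_int _ P_phi)
  (phi_int _ Q_phi) (modulusxx p) _ _ N G domG G_lip.
rewrite -[_ * s *+ N]mulr_natl mulVKf ?pnatr_eq0 -?lt0n//; apply.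
  by rewrite invr_gt0 ltr0n.
by move=> psi psiL psiP psiQ; rewrite -lee_fin; exact: zeta_ub.
Qed.
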